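(* Let $n>1$ and $p>1$ be integers and let $G=H_{n,p}$. Then $\theta(G)=0$ if $n$ is even or if $n$ and $p$ are both odd, and $\theta(G)=1$ if $n$ is odd and $p$ is even.
   Context: $H_{n,p}$ denotes the complete multipartite graph with $p$ parts each having exactly $n$ vertices. For a finite set $S$ of positive integers with $|S|=|V(G)|$, a graph $G$ is $S$-magic if there is a bijection $f:V(G)\to S$ and a constant $c$ with $\sum_{v\in N(u)} f(v)=c$ for every vertex $u$, where $N(u)$ is the set of neighbours of $u$. Let $\alpha(S)=\max S$ and $i(G)=\min \alpha(S)$ over all $S$ for which $G$ is $S$-magic; the distance magic index is $\theta(G)=i(G)-|V(G)|$ (and $\theta(G)=\infty$ if no such $S$ exists). *)

(* Defs.v *)
From mathcomp Require Import all_boot all_order all_algebra.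
From mathcomp Require Import finmap boolp constructive_ereal.
Set Implicit Arguments.
Unset Strict Implicit.
Unset Printing Implicit Defensive.

Record sgraph := SGraph {
  vertex : finType;
  adj : rel vertex;
  adj_sym : symmetric adj;
  adj_irrefl : irreflexive adj
}.

Definition neighbours (G : sgraph) (u : vertex G) : {set vertex G} :=
  [set v | adj u v].

(* The vertex (i, j) is the j-th vertex of the i-th part. *)
Definition multipartite_adj (n p : nat) : rel ('I_p * 'I_n) :=
  fun u v => u.1 != v.1.

Lemma multipartite_adj_sym (n p : nat) : symmetric (@multipartite_adj n p).
Proof. by move=> u v; rewrite /multipartite_adj eq_sym. Qed.

Lemma multipartite_adj_irrefl (n p : nat) :
  irreflexive (@multipartite_adj n p).
Proof. by move=> u; rewrite /multipartite_adj eqxx. Qed.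

Definition H (n p : nat) : sgraph :=
  SGraph (@multipartite_adj_sym n p) (@multipartite_adj_irrefl n p).

Definition magic (G : sgraph) (S : {fset nat}) : Prop :=
  [/\ forall x, x \in S -> 0 < x,
      #|` S| = #|vertex G| &
      exists f : vertex G -> S, bijective f /\
        exists c : nat, forall u : vertex G,
          \sum_(v in neighbours u) \val (f v) = c].

Definition alpha (S : {fset nat}) : nat := \max_(x <- S) x.

Definition magic_max (G : sgraph) : pred nat :=
  fun m => `[< exists S : {fset nat}, magic G S /\ alpha S = m >].

Definition magic_index (G : sgraph) (exm : exists m, magic_max G m) : nat :=
  ex_minn exm.

(* The difference is taken in int, so there is no truncation. *)
Definition theta (G : sgraph) : \bar int :=
  match pselect (exists m, magic_max G m) with
  | left exm => ((magic_index exm)%:Z - #|vertex G|%:Z)%R%:E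
  | right _ => +oo%E
  end.

(* Main.v *)
Require Import Defs.
From mathcomp Require Import all_boot all_order all_algebra.
From mathcomp Require Import finmap boolp constructive_ereal.
From mathcomp Require Import zify.
Set Implicit Arguments.
Unset Strict Implicit.
Unset Printing Implicit Defensive.

(** In [H n p] every neighbourhood sum is the total minus a part sum, so a
    labelling is magic exactly when all parts have the same sum [s].  The
    largest label is at least [n * p]; if it equals [n * p], then the labels
    are 1, ..., [n * p] and [2 * s = n * (n * p + 1)], which is impossible for
    [n] odd and [p] even.  For the constructions, arrange the labels in [n]
    rows of [p] consecutive values, column [i] being the part [i].  Two rows
    run through in opposite directions contribute equally to all columns, which
    settles [n] even; for [n] odd, three further rows with constant column sums
    are needed, and they exist if for [p] even the third row may skip its
    middle value. *)

Lemma sum_neighbours (n p : nat) (F : 'I_p * 'I_n -> nat) (u : vertex (H n p)) :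
  \sum_(v in neighbours u) F v = \sum_(i | i != u.1) \sum_j F (i, j).
Proof.
rewrite pair_big_dep /=; apply: eq_big => [v|[] //].
by rewrite inE /= /multipartite_adj eq_sym andbT.
Qed.

Lemma alpha_ge (S : {fset nat}) (x : nat) : x \in S -> x <= alpha S.
Proof. by move=> xS; rewrite /alpha (@leq_bigmax_seq _ _ xpredT id). Qed.

Lemma card_le_alpha (S : {fset nat}) :
  (forall x, x \in S -> 0 < x) -> #|` S| <= alpha S.
Proof.
move=> S_gt0; rewrite -[leqRHS](size_iota 1).
apply: uniq_leq_size => [|x xS]; first exact: fset_uniq.
by rewrite mem_iota S_gt0 //= add1n ltnS alpha_ge.
Qed.

(** A set of m positive integers with maximum m fills 1, ..., m, so Gauss's formula applies. *)
Lemma sum_fset_alpha (S : {fset nat}) :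
    (forall x, x \in S -> 0 < x) -> alpha S = #|` S| ->
  (\sum_(x <- S) x).*2 = #|` S| * #|` S|.+1.
Proof.
move=> S_gt0 aS; have sub : {subset S <= iota 1 #|` S|}.
  by move=> x xS; rewrite mem_iota S_gt0 //= add1n ltnS -aS alpha_ge.
have [|_ eqS] := uniq_min_size (fset_uniq S) sub; first by rewrite size_iota.
rewrite (perm_big (iota 1 #|` S|)) /=; last first.
  by rewrite uniq_perm ?fset_uniq ?iota_uniq.
elim: #|` S| => [|m IHm]; first by rewrite big_nil.
by rewrite -[in iota _ _](addn1 m) iotaD big_cat /= big_seq1; lia.
Qed.

Lemma magic_parts_sum (n p : nat) (S : {fset nat}) :
    0 < n -> magic (H n p) S ->
  exists s, \sum_(x <- S) x = p * s.
Proof.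
move=> n_gt0 [_ _ [f [f_bij [c fc]]]].
pose part (i : 'I_p) := \sum_(j < n) \val (f (i, j)).
have total : \sum_(x <- S) x = \sum_i part i.
  rewrite big_seq_fsetE /= (reindex f) /=; last exact: onW_bij.
  by rewrite /part pair_bigA; apply: eq_bigr => -[].
(* [0 < n] gives part [i] a vertex; its neighbours are all the other parts, so [part i + c] is the
   total and the subtraction is exact. *)
have partE i : part i = \sum_i part i - c.
  rewrite -(fc (i, Ordinal n_gt0)).
  by rewrite (sum_neighbours (fun v => \val (f v))) (bigD1 i) //= addnK.
exists (\sum_i part i - c).
by rewrite total {1}(eq_bigr _ (fun i _ => partE i)) sum_nat_const card_ord.
Qed.

Lemma odd_even_alpha (n p : nat) (S : {fset nat}) :
    odd n -> ~~ odd p -> 0 < p -> magic (H n p) S ->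
  n * p < alpha S.
Proof.
move=> n_odd p_even p_gt0 magS; have [S_gt0 cS _] := magS.
have cSE : #|` S| = n * p by rewrite cS card_prod !card_ord mulnC.
rewrite ltn_neqAle -cSE card_le_alpha // andbT; apply/eqP => aS.
have [s sE] := magic_parts_sum (odd_gt0 n_odd) magS.
have := sum_fset_alpha S_gt0 (esym aS).
rewrite sE cSE doubleMr mulnAC mulnC => /eqP; rewrite eqn_pmul2r // => /eqP.
by move/(congr1 odd); rewrite odd_double oddM /= oddM n_odd (negPf p_even).
Qed.

(* The vertex [(i, j)] gets the label [B j + r i j]. *)
Lemma magic_of_rows (n p : nat) (B : nat -> nat) (r : nat -> nat -> nat)
    (s : nat) :
    0 < p ->
    (forall i j, i < p -> 0 < r i j /\ B j + r i j <= B j.+1) ->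
    (forall i i' j, i < p -> i' < p -> r i j = r i' j -> i = i') ->
    (forall i, i < p -> \sum_(j < n) r i j = s) ->
  exists S, magic (H n p) S /\ alpha S <= B n.
Proof.
move=> p_gt0 r_bnd r_inj r_sum.
have B_mono j k : j <= k -> B j <= B k.
  move/subnK <-; elim: (k - j) => // d IHd; apply: leq_trans IHd _.
  by have [_ /(leq_trans (leq_addr _ _))] := r_bnd _ (d + j) p_gt0.
pose g (v : vertex (H n p)) := B v.2 + r v.1 v.2.
(* Row [j] has its labels between [B j + 1] and [B j.+1], so distinct rows never collide. *)
have row_lt (v w : vertex (H n p)) : v.2 < w.2 -> g v < g w.
  move=> lt_vw; have [_ gv] := r_bnd _ v.2 (ltn_ord v.1).
  have [gw _] := r_bnd _ w.2 (ltn_ord w.1).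
  by have := B_mono _ _ lt_vw; rewrite /g; lia.
have g_inj : injective g.
  move=> [i j] [i' j'] eq_g.
  have eq_j : j = j'.
    apply: val_inj; case: (ltngtP (val j) (val j')) => // lt_j.
      by have := row_lt (i, j) (i', j') lt_j; rewrite eq_g ltnn.
    by have := row_lt (i', j') (i, j) lt_j; rewrite eq_g ltnn.
  move: eq_g; rewrite /g eq_j /= => /addnI/r_inj eq_i.
  by congr (_, _); apply: val_inj; apply: eq_i.
pose S := [fset g v | v : vertex (H n p)]%fset.
have gS v : g v \in S by apply/imfsetP; exists v.
have cS : #|` S| = #|vertex (H n p)|.
  by rewrite card_imfset //= -cardE; apply: eq_card.
exists S; split; last first.
  apply/bigmax_leqP_seq => x /imfsetP[v _ ->] _ /=.
  have [_ le_g] := r_bnd _ v.2 (ltn_ord v.1).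
  exact: leq_trans le_g (B_mono _ _ (ltn_ord v.2)).
split=> // [x /imfsetP[v _ ->] /=|].
  by have [] := r_bnd _ v.2 (ltn_ord v.1); rewrite /g; lia.
exists (fun v => [` gS v]%fset); split.
  apply: inj_card_bij => [v w /(congr1 val)/= /g_inj //|].
  by rewrite -cardfE cS.
(* There are [p - 1] other parts, each with sum [\sum_(j < n) B j + s]. *)
exists ((p - 1) * (\sum_(j < n) B j + s)) => u; rewrite (sum_neighbours g).
rewrite (eq_bigr (fun _ => \sum_(j < n) B j + s)); last first.
  by move=> i _; rewrite /g big_split /= r_sum.
by rewrite sum_nat_const cardC1 card_ord subn1.
Qed.

Definition zigzag (p i j : nat) : nat := if odd j then p - i else i.+1.

(** Two consecutive rows add up to [p.+1] in every column, whatever the parity of the starting row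
    [a]. *)
Lemma sum_zigzag (p i a k : nat) :
  i < p -> \sum_(j < k.*2) zigzag p i (a + j) = k * p.+1.
Proof.
move=> lt_ip; elim: k => [|k IHk]; first by rewrite big_ord0.
rewrite doubleS !big_ord_recr /= IHk mulSn.
by rewrite /zigzag addnS /=; case: ifP => /= _; lia.
Qed.

Lemma magic_even (n p : nat) :
  ~~ odd n -> 0 < p -> exists S, magic (H n p) S /\ alpha S <= n * p.
Proof.
move=> n_even p_gt0; pose s := n./2 * p.+1.
apply: (@magic_of_rows n p (fun j => j * p) (zigzag p) s) => //.
- by move=> i j lt_ip; rewrite /zigzag mulSn; case: ifP => _; lia.
- by move=> i i' j lt_ip lt_i'p; rewrite /zigzag; case: ifP => _; lia.
by move=> i lt_ip; rewrite /s -(sum_zigzag 0 _ lt_ip) even_halfK.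
Qed.

(* With [e] the parity defect [~~ odd p] and [m = uphalf p], each column of the
   first three rows adds up to [p + m + 1 + e]; the third row takes the values
   1, ..., [p + e] except [m + 1] when [e = 1]. *)
Definition odd_rows (p i j : nat) : nat :=
  let m := uphalf p in
  match j with
  | 0 => i.+1
  | 1 => if i < m then (m - i).*2.-1 else (p - i).*2
  | 2 => if i < m then i + (p - m).+1 + ~~ odd p else (i - m).+1
  | _ => zigzag p i j
  end.

Lemma magic_odd (n p : nat) :
    odd n -> 1 < n -> 0 < p ->
  exists S, magic (H n p) S /\ alpha S <= n * p + ~~ odd p.
Proof.
move=> n_odd n_gt1 p_gt0.
have [k ->] : exists k, n = 3 + k.*2 by exists (n - 3)./2; lia.
(* For [p] even, row 2 skips a value and so spans [p + 1] integers, shifting all later rows by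
   one. *)
pose B j := j * p + (if 2 < j then ~~ odd p : nat else 0).
rewrite -[_ * p + _]/(B (3 + k.*2)).
pose s := odd_rows p 0 0 + odd_rows p 0 1 + odd_rows p 0 2 + k * p.+1.
apply: (@magic_of_rows _ p B (odd_rows p) s) => //.
- move=> i [|[|[|j]]] lt_ip; rewrite /B /odd_rows /zigzag /= ?mulSn;
    by do ?case: ifP => ?; lia.
- move=> i i' [|[|[|j]]] lt_ip lt_i'p; rewrite /odd_rows /zigzag /=;
    by do ?case: ifP => ?; lia.
move=> i lt_ip; rewrite /s big_split_ord /= !big_ord_recr big_ord0 /=.
(* With [m = uphalf p], rows 0 and 1 add up to [2m - i] for [i < m] and to [2p + 1 - i] otherwise;
   row 2 rises by one per column in each block to compensate. *)
by congr (_ + _); [do ?case: ifP => ?; lia|exact: (sum_zigzag 3)].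
Qed.

(** The witness rules out the infinite value, and the two bounds pin the minimum. *)
Lemma thetaE (G : sgraph) (d : nat) :
    (exists S, magic G S /\ alpha S <= #|vertex G| + d) ->
    (forall S, magic G S -> #|vertex G| + d <= alpha S) ->
  theta G = (d%:Z)%:E.
Proof.
move=> [S [magS le_S]] lb; rewrite /theta; case: pselect => [exm|[]]; last first.
  by exists (alpha S); apply/asboolP; exists S.
rewrite /magic_index; case: ex_minnP => m /asboolP[S' [magS' <-]] min_m.
have le_S' : alpha S' <= alpha S by apply: min_m; apply/asboolP; exists S.
have -> : alpha S' = #|vertex G| + d.
  by apply/eqP; rewrite eqn_leq lb // (leq_trans le_S').
by congr (_%:E)%E; lia.
Qed.

Theorem theorem11 (n p : nat) (hn : 1 < n) (hp : 1 < p) :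
  (~~ odd n \/ (odd n /\ odd p) -> theta (H n p) = (0%R : int)%:E) /\
  (odd n /\ ~~ odd p -> theta (H n p) = (1%R : int)%:E).
Proof.
have p_gt0 := ltnW hp.
have cV : #|vertex (H n p)| = n * p by rewrite card_prod !card_ord mulnC.
split=> [parity|[n_odd p_even]].
  apply: (@thetaE _ 0) => [|S [S_gt0 cS _]]; last first.
    by rewrite addn0 -cS card_le_alpha.
  rewrite addn0 cV; case: parity => [|[n_odd p_odd]].
    by move/magic_even; apply.
  by have := magic_odd n_odd hn p_gt0; rewrite p_odd addn0.
apply: (@thetaE _ 1) => [|S magS]; rewrite cV.
  by have := magic_odd n_odd hn p_gt0; rewrite p_even.
by rewrite addn1 odd_even_alpha.
Qed.
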